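(* Let $\mathbf{x}^*\in\mathbb{R}^{2n}$ be the minimal positive solution of $\mathbf{f}(\mathbf{x})=\mathbf{0}$ and suppose that the Jacobian matrix $\mathbf{f}'(\mathbf{x}^* )$ is nonsingular, i.e., $\alpha\ne0$ or $c\neq1$. If $c(1+\alpha)\le 1/3$, then the sequence $\{\mathbf{x}_k\}$ generated by the two-step modified Newton method starting from the zero vector $\mathbf{x}_0=\mathbf{0}\in\mathbb{R}^{2n}$ converges Q-quadratically to $\mathbf{x}^*$, and the following error bound holds: $$\|\mathbf{x}^*-\mathbf{x}_k\|_\infty<1.32\,c(1+\alpha)\,\|\mathbf{x}_k-\mathbf{x}_{k-1}\|_\infty^2,\qquad k\ge1.$$ Moreover, $\mathbf{x}^*$ belongs to the open ball $\mathbf{B}(\mathbf{0},r)=\{\mathbf{x}\in\mathbb{R}^{2n}:\|\mathbf{x}\|_\infty<r\}$, where $$\frac{1-\sqrt{1-2c(1+\alpha)}}{c(1+\alpha)}\le r<\frac{1+\sqrt{1-2c(1+\alpha)}}{c(1+\alpha)}.$$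
   Context: Data. Let $n\ge1$, $c\in(0,1]$, $\alpha\in[0,1)$. Let $\{\omega_i\}_{i=1}^n$ and $\{c_i\}_{i=1}^n$ be the Gauss-Legendre nodes and weights on $[0,1]$, with $0<\omega_n<\cdots<\omega_1<1$, $c_i>0$, $\sum_{i=1}^n c_i=1$. Put $\delta_i=\frac{1}{c\omega_i(1+\alpha)}$, $\gamma_i=\frac{1}{c\omega_i(1-\alpha)}$, $q_i=\frac{c_i}{2\omega_i}$, $P=\left(\frac{q_j}{\delta_i+\gamma_j}\right)_{n\times n}$, $\widetilde P=\left(\frac{q_j}{\gamma_i+\delta_j}\right)_{n\times n}$, and let $\mathbf{e}=(1,\dots,1)^\top\in\mathbb{R}^n$. With $\circ$ the componentwise (Hadamard) product, define for $\mathbf{x}=[\mathbf{u}^\top,\mathbf{v}^\top]^\top$, $\mathbf{u},\mathbf{v}\in\mathbb{R}^n$, $$\mathbf{f}(\mathbf{x})=\begin{bmatrix}\mathbf{u}-\mathbf{u}\circ(P\mathbf{v})-\mathbf{e}\\ \mathbf{v}-\mathbf{v}\circ(\widetilde P\mathbf{u})-\mathbf{e}\end{bmatrix}\in\mathbb{R}^{2n}.$$ $\mathbf{f}'(\mathbf{x})$ is the Jacobian matrix of $\mathbf{f}$ at $\mathbf{x}$. It is known that $\mathbf{f}'(\mathbf{x}^* )$ is singular if and only if $\alpha=0$ and $c=1$. $\mathbf{x}^*$ denotes the minimal positive solution of $\mathbf{f}(\mathbf{x})=\mathbf{0}$: the (entrywise) positive solution which is entrywise $\le$ every positive solution (its existence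 is known). Two-step modified Newton method: given $\mathbf{x}_0$, set $\mathbf{z}_{-1}=\mathbf{x}_0$ and for $k=0,1,2,\dots$ $$\mathbf{y}_k=\mathbf{x}_k-\mathbf{f}'(\mathbf{z}_{k-1})^{-1}\mathbf{f}(\mathbf{x}_k),\qquad \mathbf{z}_k=\tfrac12(\mathbf{x}_k+\mathbf{y}_k),\qquad \mathbf{x}_{k+1}=\mathbf{x}_k-\mathbf{f}'(\mathbf{z}_k)^{-1}\mathbf{f}(\mathbf{x}_k).$$ Q-quadratic convergence of $\{\mathbf{x}_k\}$ to $\mathbf{x}^*$ means: $\mathbf{x}_k\to\mathbf{x}^*$ and there is a constant $C$ with $\|\mathbf{x}^*-\mathbf{x}_{k+1}\|_\infty\le C\|\mathbf{x}^*-\mathbf{x}_k\|_\infty^2$ for all $k$. *)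

(* Defs.v *)
From HB Require Import structures.
From mathcomp Require Import all_boot all_order all_algebra.
From mathcomp Require Import all_classical all_reals all_analysis.
Set Implicit Arguments.
Unset Strict Implicit.
Unset Printing Implicit Defensive.
Import Order.TTheory GRing.Theory Num.Theory.
Import numFieldNormedType.Exports.
Local Open Scope classical_set_scope.
Local Open Scope ring_scope.

(* Rodrigues' formula for P_n(2x - 1); [p^`N(n)] is the n-th derivative
   divided by n!. *)
Definition shifted_legendre (R : realType) (n : nat) : {poly R} :=
  (('X^2 - 'X) ^+ n)^`N(n).

Definition lagrange_poly (R : realType) (n : nat) (omega : 'I_n -> R)
    (i : 'I_n) : {poly R} :=
  \prod_(j < n | j != i) ((omega i - omega j)^-1 *: ('X - (omega j)%:P)).

(* The weights are the interpolatory ones.  The bounds on the nodes, the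
   positivity of the weights and their normalisation follow from the other
   fields; they are recorded because the data are given together with them. *)
Record gauss_legendre (R : realType) (n : nat) (omega wt : 'I_n -> R) : Prop :=
  GaussLegendre {
    gl_root : forall i, root (shifted_legendre R n) (omega i);
    gl_decr : forall i j : 'I_n, (i < j)%N -> omega j < omega i;
    gl_range : forall i, 0 < omega i < 1;
    gl_weight : forall i,
      wt i = \int[lebesgue_measure]_(x in `[0, 1]) (lagrange_poly omega i).[x];
    gl_weight_gt0 : forall i, 0 < wt i;
    gl_weight_sum : \sum_(i < n) wt i = 1 }.

Section system.
Variables (R : realType) (n : nat) (c alpha : R) (omega wt : 'I_n -> R).

Definition delta_coef (i : 'I_n) : R := 1 / (c * omega i * (1 + alpha)).
Definition gamma_coef (i : 'I_n) : R := 1 / (c * omega i * (1 - alpha)).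
Definition q_coef (i : 'I_n) : R := wt i / (2 * omega i).

Definition P_mx : 'M[R]_n :=
  \matrix_(i, j) (q_coef j / (delta_coef i + gamma_coef j)).
Definition Pt_mx : 'M[R]_n :=
  \matrix_(i, j) (q_coef j / (gamma_coef i + delta_coef j)).

Definition hadamard (x y : 'cV[R]_n) : 'cV[R]_n := map2_mx *%R x y.

Definition f_sys (x : 'cV[R]_(n + n)) : 'cV[R]_(n + n) :=
  let u := usubmx x in let v := dsubmx x in
  col_mx (u - hadamard u (P_mx *m v) - const_mx 1)
         (v - hadamard v (Pt_mx *m u) - const_mx 1).

End system.

Section newton.
Variables (R : realType) (m : nat).
Implicit Types (f : 'cV[R]_m -> 'cV[R]_m) (x z : 'cV[R]_m).

(* Entry (i, j) is the partial derivative of the i-th component in the j-th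
   variable; the library's [jacobian] is the transpose, for row vectors. *)
Definition jacobian_mx f x : 'M[R]_m :=
  \matrix_(i, j) 'D_(delta_mx j 0) (fun y : 'cV[R]_m => f y i 0) x.

(* [invmx A = A] when [A] is singular, so this is the intended step only when
   the Jacobian at [z] is invertible. *)
Definition newton_step f z x : 'cV[R]_m := x - invmx (jacobian_mx f z) *m f x.

Definition two_step_update f (s : 'cV[R]_m * 'cV[R]_m) :=
  let x := s.1 in
  let y := newton_step f s.2 x in
  let z := 2^-1 *: (x + y) in
  (newton_step f z x, z).

(* After k updates the state is (x_k, z_{k-1}), with z_{-1} = x_0. *)
Definition newton_state f x0 (k : nat) := iter k (two_step_update f) (x0, x0).
Definition newton_x f x0 (k : nat) : 'cV[R]_m := (newton_state f x0 k).1.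
Definition newton_z_prev f x0 (k : nat) : 'cV[R]_m := (newton_state f x0 k).2.

(* All inverses used by the iteration exist, i.e. those at z_{k-1}, k >= 0. *)
Definition newton_well_defined f x0 : Prop :=
  forall k : nat, jacobian_mx f (newton_z_prev f x0 k) \in unitmx.

Definition positive_solution f x : Prop :=
  (forall i, 0 < x i 0) /\ f x = 0.

Definition minimal_positive_solution f x : Prop :=
  positive_solution f x /\
  forall y, positive_solution f y -> forall i, x i 0 <= y i 0.

(* The library's norm on ['cV[R]_m] is the maximum norm. *)
Definition q_quadratic_convergence (x : nat -> 'cV[R]_m) (xs : 'cV[R]_m) : Prop :=
  x @ \oo --> xs /\
  exists C : R, forall k : nat, `|xs - x k.+1| <= C * `|xs - x k| ^+ 2.

End newton.

(* Main.v *)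
Require Import Defs.
From HB Require Import structures.
From mathcomp Require Import all_boot all_order all_algebra.
From mathcomp Require Import all_classical all_reals all_analysis.
From mathcomp Require Import ring lra.
Import Order.TTheory GRing.Theory Num.Theory.
Import numFieldNormedType.Exports.
Local Open Scope classical_set_scope.
Local Open Scope ring_scope.

(* Write f(x) = x - x o Qx - e with Q = [[0, P], [P~, 0]], an entrywise
   nonnegative matrix whose row sums are < t/2 <= 1/6.  Then
   J(z)h = h - h o Qz - z o Qh, and on the box 0 <= z <= 3/2 the matrix J(z)
   has a nonnegative inverse of norm at most 2; the minimal solution xs lies in
   this box.  Put N(a)b = a o Qb + b o Qa.  One step maps x, with previous
   Jacobian point z, to y, then z' = (x + y)/2, then x'.  As f is quadratic,
     J(z) (xs - y) = N(x - z)(xs - x) + (xs - x) o Q(xs - x),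
     J(z') (x' - y) = N(z' - z)(y - x),
     J(z') (xs - x') = 1/2 N(xs - y)(xs - x),
     f(x') = 1/2 N(y - x')(x' - x),
     J((x' + xs)/2) (xs - x') = - f(x').
   The signs of the right-hand sides give x <= y <= x' < xs inductively, and
   the norms of the last three give the quadratic rate and the error bound
   (with constant 1 in place of 1.32). *)

Set Implicit Arguments.
Unset Strict Implicit.

(** * The maximum norm in coordinates *)

Section ColumnNorm.
Context (R : realType) (m : nat).
Implicit Types (x y : 'cV[R]_m) (i : 'I_m).

Lemma col_norm_coord x i : `|x i 0| <= `|x|.
Proof.
rewrite -[`|x|]/(mx_norm x) mx_normrE.
exact: (le_bigmax _ (fun ij => `|x ij.1 ij.2|) (i, 0)).
Qed.

Lemma col_norm_attained x : x != 0 -> exists i, `|x| = `|x i 0|.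
Proof.
rewrite -normr_eq0 => /mx_norm_neq0 [[i j] /= e].
by exists i; rewrite -[`|x|]/(mx_norm x) e (ord1 j).
Qed.

Lemma col_norm_le x a : 0 <= a -> (forall i, `|x i 0| <= a) -> `|x| <= a.
Proof.
move=> a0 xa; have [->|/col_norm_attained [i ->]] := eqVneq x 0 => //.
by rewrite normr0.
Qed.

Lemma entryD x y i : (x + y) i 0 = x i 0 + y i 0. Proof. by rewrite mxE. Qed.

Lemma entryN x i : (- x) i 0 = - x i 0. Proof. by rewrite mxE. Qed.

Lemma entryZ a x i : (a *: x) i 0 = a * x i 0. Proof. by rewrite mxE. Qed.

Definition entryE := (entryD, entryN, entryZ).

End ColumnNorm.

(** * The quadratic map and its Jacobian *)

Section QuadraticMap.
Context (R : realType) (m : nat) (Q : 'M[R]_m).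
Implicit Types (x y z h : 'cV[R]_m) (i j : 'I_m).

Definition quad_map x : 'cV[R]_m := x - hadamard x (Q *m x) - const_mx 1.

Definition quad_jac z : 'M[R]_m :=
  \matrix_(i, j) ((i == j)%:R * (1 - (Q *m z) i 0) - z i 0 * Q i j).

Lemma quad_mapE x i : quad_map x i 0 = x i 0 - x i 0 * (Q *m x) i 0 - 1.
Proof. by rewrite !mxE. Qed.

Lemma mul_quad_jac z h i :
  (quad_jac z *m h) i 0 =
  h i 0 - h i 0 * (Q *m z) i 0 - z i 0 * (Q *m h) i 0.
Proof.
rewrite mxE; under eq_bigr => j _ do rewrite mxE mulrBl.
rewrite sumrB (bigD1 i) //= eqxx mul1r big1 ?addr0; last first.
  by move=> j; rewrite eq_sym => /negPf ->; rewrite !mul0r.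
rewrite mulrBl mul1r [h i 0 * _]mulrC; congr (_ - _).
by rewrite [(Q *m h) i 0]mxE mulr_sumr; apply: eq_bigr => j _; rewrite mulrA.
Qed.

Lemma mulmxDE (x y : 'cV[R]_m) i :
  (Q *m (x + y)) i 0 = (Q *m x) i 0 + (Q *m y) i 0.
Proof. by rewrite mulmxDr mxE. Qed.

Lemma mulmxNE x i : (Q *m (- x)) i 0 = - (Q *m x) i 0.
Proof. by rewrite mulmxN mxE. Qed.

Lemma mulmxZE a x i : (Q *m (a *: x)) i 0 = a * (Q *m x) i 0.
Proof. by rewrite -scalemxAr mxE. Qed.

Definition mulE := (mulmxDE, mulmxNE, mulmxZE).

(** The difference quotient at [t] is exactly [a + t * b]. Expanding the map along a coordinate line
    thus gives its partial derivatives at once. *)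
Lemma derive_quadratic (g : 'cV[R]_m -> R) x v (a b : R) :
  (forall t, g (t *: v + x) = g x + t * a + t ^+ 2 * b) -> 'D_v g x = a.
Proof.
move=> gE; rewrite /derive; apply: cvg_lim => //.
have : (fun t : R => a + t * b) t @[t --> 0^'] --> a.
  rewrite -[X in _ --> X]addr0 -[X in _ + X](mul0r b).
  apply: cvgD; first exact: cvg_cst.
  apply: cvgM; last exact: cvg_cst.
  by apply: cvg_within_filter; exact: cvg_id.
apply: cvg_trans; apply: near_eq_cvg.
near=> t; rewrite /= gE.
have t0 : t != 0 by near: t; exact: nbhs_dnbhs_neq.
rewrite /GRing.scale /=; field.
Unshelve. all: by end_near. Qed.

Lemma jacobian_quad_map z : jacobian_mx quad_map z = quad_jac z.
Proof.
apply/matrixP => i j; rewrite mxE.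
have -> : quad_jac z i j = (quad_jac z *m (delta_mx j 0 : 'cV[R]_m)) i 0.
  by rewrite -colE [RHS]mxE.
apply: (@derive_quadratic _ _ _ _
  (- (delta_mx j 0 : 'cV[R]_m) i 0 * (Q *m delta_mx j 0) i 0)) => t.
rewrite mul_quad_jac !quad_mapE !mulE !entryE; ring.
Qed.

End QuadraticMap.

(** * Inverse positivity and conditioning of the Jacobian on the box [[0, s]] *)

Section Nonneg.
Context (R : realType) (m : nat) (Q : 'M[R]_m) (q s : R).
Hypothesis Q_ge0 : forall i j, 0 <= Q i j.
Hypothesis Q_sum : forall i, \sum_j Q i j <= q.
Hypothesis q_ge0 : 0 <= q.
Hypothesis qs_lt1 : 2 * (q * s) < 1.
Implicit Types (x y z h : 'cV[R]_m) (i j : 'I_m).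

Lemma Qmul_ge0 x i : (forall j, 0 <= x j 0) -> 0 <= (Q *m x) i 0.
Proof. by move=> x0; rewrite mxE sumr_ge0 // => j _; rewrite mulr_ge0. Qed.

Lemma Qmul_le_sum x a i :
  (forall j, x j 0 <= a) -> (Q *m x) i 0 <= (\sum_j Q i j) * a.
Proof.
by move=> xa; rewrite mxE mulr_suml ler_sum // => j _; rewrite ler_wpM2l.
Qed.

Lemma Qmul_le x a i :
  0 <= a -> (forall j, x j 0 <= a) -> (Q *m x) i 0 <= q * a.
Proof.
by move=> a0 xa; rewrite (le_trans (Qmul_le_sum i xa)) // ler_wpM2r.
Qed.

Lemma Qmul_norm_le x i : `|(Q *m x) i 0| <= q * `|x|.
Proof.
have xle j := col_norm_coord x j.
rewrite ler_norml lerNl -mulmxNE; apply/andP; split; apply: Qmul_le => // j.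
  by rewrite entryN (le_trans (ler_norm _)) // normrN.
by rewrite (le_trans (ler_norm _)).
Qed.

(* Minimum principle: at an index where [h] is smallest, a negative value of
   [h] would make [quad_jac Q z *m h] negative. *)
Lemma quad_jac_ge0 z h : (forall i, 0 <= z i 0 <= s) ->
  (forall i, 0 <= (quad_jac Q z *m h) i 0) -> forall i, 0 <= h i 0.
Proof.
move=> zs Jh i0.
case: (Order.TotalTheory.arg_minP (fun i => h i 0) (erefl true) :
  extremum_spec _ _ _ [arg min_(i < i0) h i 0]%O) => i _ hmin.
apply: le_trans (hmin i0 erefl); rewrite leNgt; apply/negP => hi.
have /andP[z0 zi] := zs i.
have := Jh i; rewrite mul_quad_jac.
have Qz : (Q *m z) i 0 <= q * s.
  by apply: Qmul_le => [|j]; [exact: le_trans zi | have /andP[] := zs j].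
have Qh : - (Q *m h) i 0 <= q * - h i 0.
  rewrite -mulmxNE Qmul_le ?oppr_ge0 ?ltW // => j.
  by rewrite mxE lerN2 hmin.
have e1 : z i 0 * - (Q *m h) i 0 <= s * (q * - h i 0).
  apply: le_trans (ler_wpM2l z0 Qh) _; apply: ler_wpM2r zi.
  by rewrite mulr_ge0 ?oppr_ge0 // ltW.
have e2 : - h i 0 * (Q *m z) i 0 <= - h i 0 * (q * s).
  by rewrite ler_wpM2l // oppr_ge0 ltW.
have e3 : 0 < - h i 0 * (1 - 2 * (q * s)).
  by rewrite mulr_gt0 ?oppr_gt0 ?subr_gt0.
move: e1 e2 e3; rewrite !mulrN !mulNr; lra.
Qed.

(** Once [h] is nonnegative, both products subtracted from it in [quad_jac Q z *m h] are nonnegative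
    too. This carries strict positivity of a right-hand side over to the solution. *)
Lemma quad_jac_ge z h b : (forall i, 0 <= z i 0 <= s) ->
  quad_jac Q z *m h = b -> (forall i, 0 <= b i 0) ->
  forall i, b i 0 <= h i 0.
Proof.
move=> zs <- b0 i; have h0 := quad_jac_ge0 zs b0.
rewrite mul_quad_jac -addrA gerDl -opprD oppr_le0.
have z0 j : 0 <= z j 0 by have /andP[] := zs j.
by rewrite addr_ge0 // mulr_ge0 // Qmul_ge0.
Qed.

(** At an index where the absolute value of [h] is largest, each of the two subtracted products has
    size at most [q * s * |h|]. *)
Lemma quad_jac_norm z h : (forall i, 0 <= z i 0 <= s) ->
  (1 - 2 * (q * s)) * `|h| <= `|quad_jac Q z *m h|.
Proof.
move=> zs; have [->|/col_norm_attained [i hi]] := eqVneq h 0.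
  by rewrite normr0 mulr0.
apply: le_trans (col_norm_coord _ i); rewrite mul_quad_jac.
have /andP[z0 zi] := zs i.
have s0 := le_trans z0 zi.
have e1 : `|h i 0 * (Q *m z) i 0| <= `|h| * (q * s).
  rewrite normrM -hi ler_wpM2l // ger0_norm; last first.
    by rewrite Qmul_ge0 // => j; have /andP[] := zs j.
  by apply: Qmul_le => // j; have /andP[] := zs j.
have e2 : `|z i 0 * (Q *m h) i 0| <= s * (q * `|h|).
  by rewrite normrM ler_pM // ?Qmul_norm_le // ger0_norm.
have e3 := lerB_dist (h i 0) (h i 0 * (Q *m z) i 0 + z i 0 * (Q *m h) i 0).
have e4 := ler_normD (h i 0 * (Q *m z) i 0) (z i 0 * (Q *m h) i 0).
rewrite -addrA -opprD; move: e3; rewrite -hi; lra.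
Qed.

Lemma quad_jac_unit z : (forall i, 0 <= z i 0 <= s) ->
  quad_jac Q z \in unitmx.
Proof.
(* [det0P] yields a left null vector; passing to the transpose turns it into a right one, which the
   norm bound excludes. *)
move=> zs; rewrite -unitmx_tr unitmxE unitfE; apply/det0P => -[v v0 vJ].
have := quad_jac_norm v^T zs; rewrite -[quad_jac Q z]trmxK -trmx_mul vJ.
rewrite trmx0 normr0 leNgt mulr_gt0 ?subr_gt0 // normr_gt0.
by rewrite -(inj_eq trmx_inj) trmxK trmx0.
Qed.

Lemma quad_newton_stepP z x : (forall i, 0 <= z i 0 <= s) ->
  quad_jac Q z *m (x - newton_step (quad_map Q) z x) = quad_map Q x.
Proof.
move=> zs; rewrite /newton_step opprB addrC subrK jacobian_quad_map.
by rewrite mulKVmx ?quad_jac_unit.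
Qed.

End Nonneg.

Lemma col_norm_mono (R : realType) (m : nat) (x y : 'cV[R]_m) :
  (forall i, 0 <= x i 0 <= y i 0) -> `|x| <= `|y|.
Proof.
move=> xy; apply: col_norm_le => // i; have /andP[x0 xyi] := xy i.
rewrite ger0_norm // (le_trans xyi) // (le_trans (ler_norm _)) //.
exact: col_norm_coord.
Qed.

(** * Monotonicity and error estimates for one two-step update *)

Section NewtonStep.
Context (R : realType) (m : nat) (Q : 'M[R]_m) (q s : R).
Hypothesis Q_ge0 : forall i j, 0 <= Q i j.
Hypothesis Q_pos : forall i, exists j, 0 < Q i j.
Hypothesis Q_sum : forall i, \sum_j Q i j <= q.
Hypothesis q_ge0 : 0 <= q.
Hypothesis qs_lt1 : 2 * (q * s) < 1.
Implicit Types (x y z h : 'cV[R]_m) (i j : 'I_m).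
Context (xs : 'cV[R]_m).
Hypothesis xs_root : quad_map Q xs = 0.
Hypothesis xs_le : forall i, xs i 0 <= s.

Lemma Qmul_gt0 x i : (forall j, 0 < x j 0) -> 0 < (Q *m x) i 0.
Proof.
move=> x0; have [j Qij] := Q_pos i; rewrite mxE (bigD1 j) //=.
rewrite ltr_wpDr ?mulr_gt0 // sumr_ge0 // => k _.
by rewrite mulr_ge0 // ltW.
Qed.

(** Here [w] is the polar form of x o Qx at [(a, b)]; the errors and residuals of an update all take
    this shape. *)
Lemma Qpolar_norm_le (a b w : 'cV[R]_m) :
  (forall i, w i 0 = 2^-1 * (a i 0 * (Q *m b) i 0 + b i 0 * (Q *m a) i 0)) ->
  `|w| <= q * (`|a| * `|b|).
Proof.
move=> wE; apply: col_norm_le => [|i]; first by rewrite !mulr_ge0.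
have e1 : `|a i 0 * (Q *m b) i 0| <= `|a| * (q * `|b|).
  by rewrite normrM ler_pM // ?col_norm_coord // Qmul_norm_le.
have e2 : `|b i 0 * (Q *m a) i 0| <= `|b| * (q * `|a|).
  by rewrite normrM ler_pM // ?col_norm_coord // Qmul_norm_le.
rewrite wE normrM ger0_norm ?invr_ge0 //.
have := ler_normD (a i 0 * (Q *m b) i 0) (b i 0 * (Q *m a) i 0).
lra.
Qed.

(* The iterates increase towards the root: [z] is the previous evaluation
   point of the Jacobian and [x] the current iterate. *)
Definition below z x :=
  forall i, [/\ 0 <= z i 0, z i 0 <= x i 0, x i 0 < xs i 0
    & quad_map Q x i 0 <= 0].

Lemma below_itv z x : below z x -> forall i, 0 <= z i 0 <= s.
Proof.
move=> zx i; have [-> zxi xxs _] := zx i.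
by rewrite (le_trans zxi) // (le_trans (ltW xxs)).
Qed.

Section Step.
Context (z x y z' x' : 'cV[R]_m).
Hypothesis zx : below z x.
Hypothesis stepy : quad_jac Q z *m (x - y) = quad_map Q x.
Hypothesis z'_mid : z' = 2^-1 *: (x + y).
Hypothesis stepx : quad_jac Q z' *m (x - x') = quad_map Q x.

Let xsE i : xs i 0 - xs i 0 * (Q *m xs) i 0 - 1 = 0.
Proof. by rewrite -quad_mapE xs_root mxE. Qed.

Let z_itv := below_itv zx.

Let xy i : x i 0 <= y i 0.
Proof.
rewrite -subr_ge0 -entryN -entryD.
apply: (quad_jac_ge0 Q_ge0 Q_sum q_ge0 qs_lt1 z_itv) => {}i.
rewrite -opprB mulmxN entryN stepy oppr_ge0.
by case: (zx i).
Qed.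

Let y_lt i : y i 0 < xs i 0.
Proof.
have d0 j : 0 < (xs - x) j 0.
  by rewrite entryD entryN subr_gt0; case: (zx j).
have xz0 j : 0 <= (x - z) j 0.
  by rewrite entryD entryN subr_ge0; case: (zx j).
have JE j : (quad_jac Q z *m (xs - y)) j 0 =
    (xs - x) j 0 * (Q *m (x - z)) j 0 + (x - z) j 0 * (Q *m (xs - x)) j 0 +
    (xs - x) j 0 * (Q *m (xs - x)) j 0.
  rewrite (_ : xs - y = (xs - x) + (x - y)); last by rewrite addrA subrK.
  rewrite mulmxDr stepy [LHS]entryD quad_mapE mul_quad_jac !mulE !entryE.
  have := xsE j; lra.
(* The first two terms come from the lag [z <= x] and are nonnegative; the last is positive because
   each row of [Q] has a positive entry. *)
have J0 j : 0 < (quad_jac Q z *m (xs - y)) j 0.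
  have d_ge0 k : 0 <= (xs - x) k 0 by exact: ltW.
  rewrite JE ltr_wpDl //; first by rewrite addr_ge0 // mulr_ge0 // Qmul_ge0.
  by rewrite mulr_gt0 // Qmul_gt0.
rewrite -subr_gt0 -entryN -entryD (lt_le_trans (J0 i)) //.
by apply: (quad_jac_ge Q_ge0 Q_sum q_ge0 qs_lt1 z_itv erefl) => j; exact/ltW.
Qed.

Let z'E i : z' i 0 = 2^-1 * (x i 0 + y i 0).
Proof. by rewrite z'_mid !entryE. Qed.

Let xz' i : x i 0 <= z' i 0.
Proof. by rewrite z'E; have := xy i; lra. Qed.

(** This does not involve [x']: it makes the Jacobian at [z'] invertible, from which the equation
    [stepx] is later obtained. *)
Lemma midpoint_itv i : 0 <= z' i 0 <= s.
Proof.
rewrite z'E; have := xy i; have := y_lt i; have := xs_le i.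
by case: (zx i) => ? ? ? _ ? ? ?; apply/andP; split; lra.
Qed.

(** Both steps solve a system with right-hand side f(x), so J(z')(x' - y) = (J(z') - J(z))(x - y), a
    product of two nonpositive factors. *)
Let yx' i : y i 0 <= x' i 0.
Proof.
rewrite -subr_ge0 -entryN -entryD.
apply: (quad_jac_ge0 Q_ge0 Q_sum q_ge0 qs_lt1 midpoint_itv) => {}i.
have -> : (quad_jac Q z' *m (x' - y)) i 0 =
    (y - x) i 0 * (Q *m (z' - z)) i 0 + (z' - z) i 0 * (Q *m (y - x)) i 0.
  rewrite (_ : x' - y = (x - y) - (x - x')); last first.
    by rewrite opprB [RHS]addrC addrA subrK.
  rewrite mulmxDr mulmxN stepx -stepy [LHS]entryD entryN.
  rewrite !mul_quad_jac !mulE !entryE.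
  ring.
have yx0 j : 0 <= (y - x) j 0 by rewrite !entryE subr_ge0.
have zz0 j : 0 <= (z' - z) j 0.
  by rewrite !entryE subr_ge0; case: (zx j) => _ /le_trans -> //.
by rewrite addr_ge0 // mulr_ge0 ?Qmul_ge0.
Qed.

(** For w = (x + xs)/2, the exact expansion 0 = f(x) + J(w)(xs - x) gives J(z')(xs - x') = (J(z') -
    J(w))(xs - x), and w - z' = (xs - y)/2. *)
Let err_jac i : (quad_jac Q z' *m (xs - x')) i 0 =
  2^-1 * ((xs - y) i 0 * (Q *m (xs - x)) i 0 +
          (xs - x) i 0 * (Q *m (xs - y)) i 0).
Proof.
rewrite (_ : xs - x' = (xs - x) + (x - x')); last by rewrite addrA subrK.
rewrite mulmxDr stepx [LHS]entryD quad_mapE mul_quad_jac z'_mid !mulE !entryE.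
have := xsE i; lra.
Qed.

Let x'_lt i : x' i 0 < xs i 0.
Proof.
have d0 j : 0 < (xs - x) j 0.
  by rewrite !entryE subr_gt0; case: (zx j).
have e0 j : 0 < (xs - y) j 0 by rewrite !entryE subr_gt0.
have J0 j : 0 < (quad_jac Q z' *m (xs - x')) j 0.
  by rewrite err_jac mulr_gt0 ?invr_gt0 // addr_gt0 // mulr_gt0 // Qmul_gt0.
rewrite -subr_gt0 -entryN -entryD (lt_le_trans (J0 i)) //.
apply: (quad_jac_ge Q_ge0 Q_sum q_ge0 qs_lt1 midpoint_itv erefl) => j.
exact/ltW.
Qed.

(** The same midpoint expansion, now between x and x': the true midpoint differs from [z'] by (x' -
    y)/2. *)
Let residual i : quad_map Q x' i 0 =
  2^-1 * ((y - x') i 0 * (Q *m (x' - x)) i 0 +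
          (x' - x) i 0 * (Q *m (y - x')) i 0).
Proof.
have := congr1 (fun w : 'cV[R]_m => w i 0) stepx.
rewrite mul_quad_jac !quad_mapE z'_mid !mulE !entryE; lra.
Qed.

Lemma below_step : below z' x'.
Proof.
move=> i; split=> //; first by have /andP[] := midpoint_itv i.
  by rewrite z'E; have := xy i; have := yx' i; lra.
have x'x0 j : 0 <= (x' - x) j 0 by rewrite !entryE subr_ge0 (le_trans (xy j)).
have x'y0 j : 0 <= (x' - y) j 0 by rewrite !entryE subr_ge0.
rewrite residual -(opprB x' y) mulmxNE (entryN (x' - y)).
rewrite mulNr mulrN -opprD mulrN oppr_le0.
by rewrite mulr_ge0 // addr_ge0 // mulr_ge0 // Qmul_ge0.
Qed.

Lemma newton_error_quadratic :
  (1 - 2 * (q * s)) * `|xs - x'| <= q * `|xs - x| ^+ 2.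
Proof.
apply: le_trans (quad_jac_norm Q_ge0 Q_sum _ midpoint_itv) _.
apply: le_trans (Qpolar_norm_le err_jac) _.
rewrite ler_wpM2l // expr2 ler_wpM2r // col_norm_mono // => i.
rewrite !entryE; have := xy i; have := y_lt i.
by move=> *; apply/andP; split; lra.
Qed.

(* As [F] is quadratic and [F xs = 0], the increment of [F] from [x'] to [xs]
   is given exactly by the Jacobian at their midpoint. *)
Lemma newton_error_increment :
  (1 - 2 * (q * s)) * `|xs - x'| <= q * `|x' - x| ^+ 2.
Proof.
pose w := 2^-1 *: (x' + xs).
have w_itv i : 0 <= w i 0 <= s.
  rewrite !entryE; have [+ + + _] := below_step i; have := xs_le i.
  by move=> *; apply/andP; split; lra.
apply: le_trans (quad_jac_norm Q_ge0 Q_sum _ w_itv) _.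
apply: le_trans (_ : q * (`|x' - y| * `|x' - x|) <= _).
  apply: Qpolar_norm_le => i; have := residual i; have := xsE i.
  rewrite quad_mapE mul_quad_jac /w !mulE !entryE; lra.
rewrite ler_wpM2l // expr2 ler_wpM2r // col_norm_mono // => i.
rewrite !entryE; have := xy i; have := yx' i.
by move=> *; apply/andP; split; lra.
Qed.

End Step.

Lemma below0 : (forall i, 0 < xs i 0) -> below 0 0.
Proof. by move=> xs0 i; split; rewrite ?quad_mapE !mxE // mul0r; lra. Qed.

(** * The full sequence of iterates and its convergence *)

Section Iteration.
Hypothesis xs_gt0 : forall i, 0 < xs i 0.
Let F := quad_map Q.

Lemma newton_step_eqs z x : below z x ->
  let y := newton_step F z x in let z' := 2^-1 *: (x + y) in
  quad_jac Q z *m (x - y) = F x /\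
  quad_jac Q z' *m (x - newton_step F z' x) = F x.
Proof.
move=> zx y z'.
have stepy : quad_jac Q z *m (x - y) = F x.
  exact: (quad_newton_stepP Q_ge0 Q_sum qs_lt1 _ (below_itv zx)).
apply: (conj stepy); apply: (quad_newton_stepP Q_ge0 Q_sum qs_lt1).
exact: (midpoint_itv zx stepy erefl).
Qed.

Lemma below_newton k : below (newton_z_prev F 0 k) (newton_x F 0 k).
Proof.
elim: k => [|k IH]; first exact: below0.
have [stepy stepx] := newton_step_eqs IH.
exact: below_step IH stepy erefl stepx.
Qed.

Lemma quad_newton_well_defined : newton_well_defined F 0.
Proof.
move=> k; rewrite jacobian_quad_map.
apply: (quad_jac_unit Q_ge0 Q_sum qs_lt1 (below_itv _)).
exact: below_newton.
Qed.

Lemma newton_quadratic k : (1 - 2 * (q * s)) * `|xs - newton_x F 0 k.+1|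
  <= q * `|xs - newton_x F 0 k| ^+ 2.
Proof.
have [stepy stepx] := newton_step_eqs (below_newton k).
exact: newton_error_quadratic (below_newton k) stepy erefl stepx.
Qed.

Lemma newton_increment k : (1 - 2 * (q * s)) * `|xs - newton_x F 0 k.+1|
  <= q * `|newton_x F 0 k.+1 - newton_x F 0 k| ^+ 2.
Proof.
have [stepy stepx] := newton_step_eqs (below_newton k).
exact: newton_error_increment (below_newton k) stepy erefl stepx.
Qed.

(** A nonzero error is what makes the final error bound strict. *)
Lemma newton_lt_root k : (0 < m)%N -> 0 < `|xs - newton_x F 0 k|.
Proof.
move=> m0; rewrite normr_gt0; apply/eqP => /matrixP /(_ (Ordinal m0) 0).
rewrite !entryE mxE => e; have [_ _ + _] := below_newton k (Ordinal m0).
by rewrite -subr_gt0 e ltxx.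
Qed.

Lemma newton_cvg : 0 <= s -> 4 * (q * s) <= 1 -> newton_x F 0 @ \oo --> xs.
Proof.
move=> s0 qs.
have xs_norm : `|xs| <= s.
  by apply: col_norm_le => // i; rewrite gtr0_norm.
(* Since d <= s, the quadratic estimate gives (1 - 2qs) d' <= qs d, with qs <= 1/4 and 1 - 2qs >=
   1/2, so the error at least halves. *)
have half k : `|xs - newton_x F 0 k| <= s * 2^-1 ^+ k.
  elim: k => [|k IH]; first by rewrite subr0 mulr1.
  have ds : `|xs - newton_x F 0 k| <= s.
    by rewrite (le_trans IH) // ler_piMr // exprn_ile1 //; lra.
  have := newton_quadratic k; set d := `|_ - newton_x F 0 k| in IH ds *.
  set d' := `|_ - _|.
  have d0 : 0 <= d by exact: normr_ge0.
  have d'0 : 0 <= d' by exact: normr_ge0.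
  have e1 : q * d ^+ 2 <= q * s * d.
    by rewrite expr2 -mulrA ler_wpM2l // ler_wpM2r.
  have e2 : q * s * d <= 4^-1 * d by rewrite ler_wpM2r //; lra.
  have e3 : 2^-1 * d' <= (1 - 2 * (q * s)) * d' by rewrite ler_wpM2r //; lra.
  rewrite [_ ^+ k.+1]exprS; move: e1 e2 e3 IH; lra.
apply/subr_cvg0/norm_cvg0P.
have g0 : geometric s 2^-1 @ \oo --> (0 : R).
  by apply: cvg_geometric; rewrite ger0_norm ?invr_ge0 //; lra.
apply: (squeeze_cvgr _ (cvg_cst 0) g0); near=> k.
by rewrite normr_ge0 distrC half.
Unshelve. all: by end_near. Qed.

End Iteration.
End NewtonStep.

(* Monotone fixed-point iteration of [x |-> e + x o Qx] from [0], which
   preserves the box [[0, s]] because [1 + q s^2 <= s]. *)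
Lemma quad_map_root_exists (R : realType) (m : nat) (Q : 'M[R]_m) (q s : R) :
  (forall i j, 0 <= Q i j) -> (forall i, \sum_j Q i j <= q) -> 0 <= s ->
  1 + q * s ^+ 2 <= s ->
  exists2 x : 'cV[R]_m, quad_map Q x = 0 & forall i, 0 < x i 0 <= s.
Proof.
move=> Q0 Qs s0 qs.
pose G (x : 'cV[R]_m) : 'cV[R]_m := \col_i (1 + x i 0 * (Q *m x) i 0).
have GE (x : 'cV[R]_m) i : G x i 0 = 1 + x i 0 * (Q *m x) i 0 by rewrite mxE.
pose a k := iter k G 0.
have a0 k i : 0 <= a k i 0.
  elim: k i => [|k IH] i; first by rewrite mxE.
  by rewrite GE addr_ge0 // mulr_ge0 // (Qmul_ge0 Q0).
have aS k i : a k i 0 <= a k.+1 i 0.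
  elim: k i => [|k IH] i; first by rewrite mxE a0.
  have QaS : (Q *m a k) i 0 <= (Q *m a k.+1) i 0.
    by rewrite [leLHS]mxE [leRHS]mxE ler_sum // => j _; rewrite ler_wpM2l.
  rewrite [leLHS](GE (a k)) [leRHS](GE (a k.+1)) lerD2l.
  by rewrite ler_pM // (Qmul_ge0 Q0).
have as_ k i : a k i 0 <= s.
  elim: k i => [|k IH] i; first by rewrite mxE.
  rewrite GE (le_trans _ qs) // lerD2l expr2 mulrCA ler_pM // ?(Qmul_ge0 Q0) //.
  exact: (Qmul_le Q0 Qs).
have a_cvg i : (fun k => a k i 0) @ \oo --> limn (fun k => a k i 0).
  apply: nondecreasing_is_cvgn; first by apply/nondecreasing_seqP => k.
  by exists s => _ [k _ <-].
pose l : 'cV[R]_m := \col_i limn (fun k => a k i 0).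
have lE i : l i 0 = limn (fun k => a k i 0) by rewrite mxE.
have l_le i : l i 0 <= s.
  rewrite lE; apply: limr_le; first by apply/cvg_ex; eexists; exact: a_cvg.
  by near=> k.
have l_ge i : 1 <= l i 0.
  rewrite lE; apply: limr_ge; first by apply/cvg_ex; eexists; exact: a_cvg.
  (* [a 0] is zero, so the lower bound 1 starts at index 1. *)
  near=> k; rewrite -(@prednK k); last by near: k; exists 1%N.
  by rewrite /= GE lerDl mulr_ge0 // (Qmul_ge0 Q0).
exists l; last by move=> i; rewrite l_le (lt_le_trans ltr01).
apply/colP => i; rewrite quad_mapE [RHS]mxE.
suff : l i 0 = 1 + l i 0 * (Q *m l) i 0 by lra.
(* Shifting the index turns the sequence into [G (a k)], whose limit is computed termwise. *)
rewrite {1}lE; apply: cvg_lim => //; rewrite -cvg_shiftS /=.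
under eq_fun do rewrite GE.
apply: cvgD; first exact: cvg_cst.
rewrite lE; apply: cvgM; first exact: a_cvg.
under eq_fun do rewrite mxE.
rewrite mxE; apply: cvg_big => [|j _]; first exact: add_continuous.
by rewrite lE; apply: cvgM; [exact: cvg_cst|exact: a_cvg].
Unshelve. all: by end_near. Qed.

(** * Positivity and row sums of the matrix of the system *)

Section Kernel.
Context (R : realType) (n : nat) (c alpha : R) (omega wt : 'I_n -> R).
Hypothesis c_gt0 : 0 < c.
Hypothesis alpha_itv : 0 <= alpha < 1.
Hypothesis omega_gt0 : forall i, 0 < omega i.
Hypothesis wt_gt0 : forall i, 0 < wt i.
Hypothesis wt_sum : \sum_(i < n) wt i = 1.

Definition sys_mx : 'M[R]_(n + n) :=
  block_mx 0 (P_mx c alpha omega wt) (Pt_mx c alpha omega wt) 0.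

Lemma f_sysE : f_sys c alpha omega wt = quad_map sys_mx.
Proof.
apply/funext => x; rewrite /f_sys /quad_map /sys_mx.
move: (usubmx x) (dsubmx x) (vsubmxK x) => u v <-.
rewrite mul_block_col !mul0mx add0r addr0.
by rewrite /hadamard map2_col_mx -col_mx_const !opp_col_mx !add_col_mx.
Qed.

(** The entry equals [w * (c * b / 2)] times a ratio in (0, 1), the factor 1/[wj] having cancelled.
    Taking [a], [b] as 1 + alpha and 1 - alpha in either order covers both matrices. *)
Lemma kernel_bounds (w wi wj a b : R) : 0 < w -> 0 < wi -> 0 < wj ->
  0 < a -> 0 < b ->
  0 < w / (2 * wj) / (1 / (c * wi * a) + 1 / (c * wj * b)) < w * (c * b / 2).
Proof.
move=> w0 wi0 wj0 a0 b0.
have ia : 0 < wi * a by rewrite mulr_gt0.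
have jb : 0 < wj * b by rewrite mulr_gt0.
have -> : w / (2 * wj) / (1 / (c * wi * a) + 1 / (c * wj * b)) =
    w * (c * b / 2) * (wi * a / (wi * a + wj * b)).
  by field; rewrite !gt_eqF // addr_gt0.
have wcb : 0 < w * (c * b / 2) by rewrite !mulr_gt0 // invr_gt0.
have S0 : 0 < wi * a + wj * b by rewrite addr_gt0.
rewrite mulr_gt0 ?divr_gt0 //= gtr_pMr // ltr_pdivrMr // mul1r.
by rewrite ltrDl.
Qed.

Let ap : 0 < 1 + alpha. Proof. by case/andP: alpha_itv; lra. Qed.
Let am : 0 < 1 - alpha. Proof. by case/andP: alpha_itv; lra. Qed.

Lemma P_mx_bounds i j : 0 < P_mx c alpha omega wt i j <
  wt j * (c * (1 + alpha) / 2).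
Proof.
rewrite mxE; have /andP[-> /lt_le_trans ->] //= :=
  kernel_bounds (wt_gt0 j) (omega_gt0 i) (omega_gt0 j) ap am.
have /andP[a0 _] := alpha_itv.
by rewrite ler_pM2l // ler_pM2r ?invr_gt0 // ler_pM2l //; lra.
Qed.

Lemma Pt_mx_bounds i j : 0 < Pt_mx c alpha omega wt i j <
  wt j * (c * (1 + alpha) / 2).
Proof. by rewrite mxE; exact: kernel_bounds. Qed.

Lemma sys_mx_ge0 i j : 0 <= sys_mx i j.
Proof.
rewrite /sys_mx; case: (split_ordP i) => k ->; case: (split_ordP j) => l ->.
- by rewrite block_mxEul mxE.
- by rewrite block_mxEur ltW //; case/andP: (P_mx_bounds k l).
- by rewrite block_mxEdl ltW //; case/andP: (Pt_mx_bounds k l).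
- by rewrite block_mxEdr mxE.
Qed.

Lemma sys_mx_pos i : exists j, 0 < sys_mx i j.
Proof.
rewrite /sys_mx; case: (split_ordP i) => k ->.
  by exists (rshift n k); rewrite block_mxEur; case/andP: (P_mx_bounds k k).
by exists (lshift n k); rewrite block_mxEdl; case/andP: (Pt_mx_bounds k k).
Qed.

Lemma sys_mx_sum i : \sum_j sys_mx i j < c * (1 + alpha) / 2.
Proof.
have -> : c * (1 + alpha) / 2 = \sum_j wt j * (c * (1 + alpha) / 2).
  by rewrite -mulr_suml wt_sum mul1r.
rewrite big_split_ord /= /sys_mx.
case: (split_ordP i) => k ->.
  rewrite big1 ?add0r => [|j _]; last by rewrite block_mxEul mxE.
  under eq_bigr => j _ do rewrite block_mxEur.
  apply: ltr_sum => [|j _]; last by case/andP: (P_mx_bounds k j).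
  (* Strictness needs a nonempty sum, witnessed by the row index. *)
  by apply/hasP; exists k; rewrite ?mem_index_enum.
rewrite [X in _ + X]big1 ?addr0 => [|j _]; last by rewrite block_mxEdr mxE.
under eq_bigr => j _ do rewrite block_mxEdl.
apply: ltr_sum => [|j _]; last by case/andP: (Pt_mx_bounds k j).
by apply/hasP; exists k; rewrite ?mem_index_enum.
Qed.

End Kernel.

(** * Locating the root in a ball, and the final result *)

(** The inequality on [M] says (1 - tM)^2 > 1 - 2t, and [t * M < 1] selects the branch left of the
    vertex 1/t of the parabola. *)
Lemma lt_small_root (R : realType) (t M : R) : 0 < t -> t * M < 1 ->
  M < 1 + t / 2 * M ^+ 2 -> M < (1 - Num.sqrt (1 - 2 * t)) / t.
Proof.
move=> t0 tM M1; rewrite ltr_pdivlMr // mulrC ltrBrDl -ltrBrDr.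
have tM0 : 0 < 1 - t * M by rewrite subr_gt0.
rewrite -[ltRHS]ger0_norm ?ltW // -sqrtr_sqr ltr_sqrt ?exprn_gt0 //.
by have : t * M < t * (1 + t / 2 * M ^+ 2); [rewrite ltr_pM2l | lra].
Qed.

Unset Implicit Arguments.
Set Strict Implicit.

Theorem corollary4p1 (R : realType) (n : nat) (hn : (1 <= n)%N)
    (c alpha : R) (hc : 0 < c <= 1) (halpha : 0 <= alpha < 1)
    (omega wt : 'I_n -> R) (hGL : gauss_legendre omega wt)
    (xs : 'cV[R]_(n + n))
    (hxs : minimal_positive_solution (f_sys c alpha omega wt) xs)
    (hJ : jacobian_mx (f_sys c alpha omega wt) xs \in unitmx)
    (hcalpha : c * (1 + alpha) <= 1 / 3) :
  let f := f_sys c alpha omega wt in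
  let x := newton_x f 0 in
  let t := c * (1 + alpha) in
  [/\ newton_well_defined f 0,
      q_quadratic_convergence x xs,
      forall k : nat, (1 <= k)%N ->
        `|xs - x k| < 132 / 100 * c * (1 + alpha) * `|x k - x k.-1| ^+ 2
    & forall r : R,
        (1 - Num.sqrt (1 - 2 * t)) / t <= r ->
        r < (1 + Num.sqrt (1 - 2 * t)) / t ->
        `|xs| < r].
Proof.
move=> f x t.
have c0 : 0 < c by case/andP: hc.
have omega0 i : 0 < omega i by case/andP: (gl_range hGL i).
have wt0 := gl_weight_gt0 hGL; have wt1 := gl_weight_sum hGL.
have t0 : 0 < t by case/andP: halpha => ? ?; rewrite mulr_gt0 //; lra.
have t3 : t <= 1 / 3 by [].
have fE : f = quad_map (sys_mx c alpha omega wt) by exact: f_sysE.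
set Q := sys_mx c alpha omega wt in fE.
have Q0 : forall i j, 0 <= Q i j by exact: sys_mx_ge0.
have Qpos : forall i, exists j, 0 < Q i j by exact: sys_mx_pos.
have Qlt : forall i, \sum_j Q i j < t / 2 by exact: sys_mx_sum.
have Qle i : \sum_j Q i j <= t / 2 by exact: ltW.
have [[xs0 fxs] xs_min] := hxs.
(* The choice s = 3/2 satisfies 1 + (t/2)s^2 <= s for t <= 4/9, while 4(t/2)s = 3t <= 1. Minimality
   puts [xs] below the root found in the box. *)
have xs_le i : xs i 0 <= 3 / 2.
  have [y fy y_itv] := quad_map_root_exists Q0 Qle
    (ltac:(lra) : 0 <= 3 / 2) (ltac:(lra) : 1 + t / 2 * (3 / 2) ^+ 2 <= 3 / 2).
  have /andP[_] := y_itv i; apply: le_trans; apply: xs_min; split.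
    by move=> j; case/andP: (y_itv j).
  by rewrite -/f fE.
have q0 : 0 <= t / 2 by lra.
have qs : 2 * (t / 2 * (3 / 2)) < 1 by lra.
have Fxs : quad_map Q xs = 0 by rewrite -fE.
(* As 1 - 3t/2 >= 1/2, both error estimates hold with constant 2(t/2) = t. *)
have half (d : R) : 0 <= d -> 2^-1 * d <= (1 - 2 * (t / 2 * (3 / 2))) * d.
  by move=> d0; rewrite ler_wpM2r //; lra.
rewrite {}/x fE; split.
- exact: (quad_newton_well_defined Q0 Qpos Qle q0 qs Fxs xs_le xs0).
- split.
    by apply: (newton_cvg Q0 Qpos Qle q0 qs Fxs xs_le xs0); lra.
  exists t => k.
  have := newton_quadratic Q0 Qpos Qle q0 qs Fxs xs_le xs0 k.
  have := half _ (normr_ge0 (xs - newton_x (quad_map Q) 0 k.+1)); lra.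
- case=> // k _ /=.
  have := newton_increment Q0 Qpos Qle q0 qs Fxs xs_le xs0 k.
  have := half _ (normr_ge0 (xs - newton_x (quad_map Q) 0 k.+1)).
  have := newton_lt_root Q0 Qpos Qle q0 qs Fxs xs_le xs0 k.+1
    (leq_trans hn (leq_addr n n)).
  rewrite -[132 / 100 * c * _]mulrA -/t.
  set d := `|_ - _|; set h := `|_ - _|; move=> d0 e1 e2.
  have : 0 < t * h ^+ 2 by lra.
  lra.
- move=> r tr _; apply: lt_le_trans tr.
  have xs_neq0 : xs != 0.
    apply/eqP => /colP /(_ (lshift n (Ordinal hn))); rewrite mxE => e.
    by have := xs0 (lshift n (Ordinal hn)); rewrite e ltxx.
  (* At an index where [xs] attains its norm M, the equation reads M = 1 + M(Q xs)_i < 1 + (t/2)M^2,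
     by strictness of the row sums. *)
  have [i Mi] := col_norm_attained xs_neq0.
  have M0 : 0 < `|xs| by rewrite normr_gt0.
  have xsM j : xs j 0 <= `|xs|.
    by apply: le_trans (col_norm_coord xs j); exact: ler_norm.
  have M32 : `|xs| <= 3 / 2 by rewrite Mi gtr0_norm.
  apply: lt_small_root => //.
    by rewrite (le_lt_trans (ler_wpM2l (ltW t0) M32)) //; lra.
  have xsi : xs i 0 = `|xs| by rewrite Mi gtr0_norm.
  have := quad_mapE Q xs i; rewrite Fxs mxE xsi.
  have Qxs : (Q *m xs) i 0 < t / 2 * `|xs|.
    by rewrite (le_lt_trans (Qmul_le_sum Q0 i xsM)) // ltr_pM2r.
  have : `|xs| * (Q *m xs) i 0 < `|xs| * (t / 2 * `|xs|) by rewrite ltr_pM2l.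
  lra.
Qed.
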